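(* Let $\Gamma=(G,\sigma)$ be a connected signed graph of order $n$ containing at least one cycle, with girth $g$. Then $\eta(\Gamma)\le n-g+2$. Equality holds if and only if $\Gamma$ is a balanced cycle $C_g^\sigma$ with $g\equiv 0\pmod 4$, or an unbalanced cycle $C_g^\sigma$ with $g\equiv 2\pmod 4$, or $\Gamma$ is switching equivalent to $(K_{n_1,n_2},+)$.
   Context: A signed graph $\Gamma=(G,\sigma)$ is a simple graph $G$ with a sign function $\sigma:E(G)\to\{+,-\}$; $(G,+)$ denotes all edges positive. Its adjacency matrix has $(u,v)$-entry $\sigma(uv)$ if $uv\in E(G)$, $0$ otherwise; $\eta(\Gamma)$ (the nullity) is the multiplicity of $0$ as an eigenvalue. A cycle is balanced if the product of its edge signs is $+$, unbalanced otherwise. Switching by $\theta:V\to\{+,-\}$ replaces $\sigma(xy)$ by $\theta(x)\sigma(xy)\theta(y)$; switching equivalent signed graphs are related by a switching. The girth is the length of a shortest cycle. $K_{n_1,n_2}$ is the complete bipartite graph with parts of sizes $n_1,n_2$. *)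

(* Defs.v *)
From HB Require Import structures.
From mathcomp Require Import all_boot all_order all_algebra.
Set Implicit Arguments. Unset Strict Implicit. Unset Printing Implicit Defensive.
Import Order.TTheory GRing.Theory Num.Theory.

(* A signed graph on the finite vertex type T is given by an edge relation
   e : rel T (required symmetric and irreflexive in the theorem) together with
   a sign function s : T -> T -> bool (required symmetric), where
   s u v = true means the edge uv is NEGATIVE; s is only relevant on edges. *)

Section SignedGraphs.
Variable T : finType.

Definition sgn_entry (R : pzRingType) (b : bool) : R := if b then (-1)%R else 1%R.

Definition sadj (e : rel T) (s : T -> T -> bool) : 'M[rat]_#|T| :=
  \matrix_(i, j) (if e (enum_val i) (enum_val j)
                  then sgn_entry rat (s (enum_val i) (enum_val j)) else 0%R).

Definition nullity (e : rel T) (s : T -> T -> bool) : nat :=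
  mup 0%R (char_poly (sadj e s)).

Definition connected (e : rel T) : Prop := forall x y : T, connect e x y.

Definition is_cycle (e : rel T) (c : seq T) : bool :=
  [&& 3 <= size c, uniq c & path.cycle e c].

Definition girth (e : rel T) (g : nat) : Prop :=
  (exists c, is_cycle e c /\ size c = g) /\
  (forall c, is_cycle e c -> g <= size c).

Definition cycle_edges (c : seq T) : seq (T * T) :=
  zip c (rot 1 c).
Definition balanced_cycle (s : T -> T -> bool) (c : seq T) : bool :=
  ~~ odd (count (fun p : T * T => s p.1 p.2) (cycle_edges c)).

Definition graph_is_cycle (e : rel T) (c : seq T) : Prop :=
  is_cycle e c /\ size c = #|T| /\
  (forall u v, e u v -> (next c u == v) || (next c v == u)).

(* switching by theta : the new sign of uv is theta u * s uv * theta v *)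
Definition switch (theta : T -> bool) (s : T -> T -> bool) : T -> T -> bool :=
  fun u v => xorb (theta u) (xorb (s u v) (theta v)).

Definition complete_bipartite (e : rel T) : Prop :=
  exists A : {set T}, [/\ A != set0, ~: A != set0 &
    forall u v, e u v = ((u \in A) != (v \in A))].

Definition switching_equiv_Kpos (e : rel T) (s : T -> T -> bool) : Prop :=
  complete_bipartite e /\
  exists theta : T -> bool, forall u v, e u v -> switch theta s u v = false.

End SignedGraphs.

(* Main.v *)
(* A symmetric rational matrix of order n has nullity n minus its rank r, so the
   bound reads r >= g - 2. A shortest cycle v_0, ..., v_(g-1) has no chord, hence
   the rows v_1, ..., v_(g-2) and the columns v_2, ..., v_(g-1) select a triangular
   submatrix with nonzero diagonal.
   Suppose now r = g - 2. An edge forces r >= 2, so g >= 4. If g = 4, the rank is 2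
   and any edge ab determines the matrix through
   A_xy A_ab = A_xa A_by + A_xb A_ay; in a connected triangle-free graph this forces
   a complete bipartite graph switching equivalent to all-positive. If g > 4, a vertex
   outside the cycle with a neighbour on it has only one (two would give a cycle of
   length at most 2 + g/2 < g), and it extends the triangular submatrix to size g - 1;
   so the graph is the cycle. There some nonzero kernel vector vanishes at v_1, and the
   recursion a_i x_i + a_(i+1) x_(i+2) = 0 must close up after g steps, which happens
   exactly when g is even and (-1)^(g/2) times the product of the signs is 1. *)
Require Import Defs.
From mathcomp Require Import all_boot all_order all_algebra zify ring.
Set Implicit Arguments. Unset Strict Implicit. Unset Printing Implicit Defensive.
Import Order.TTheory GRing.Theory Num.Theory.

(** * Nullity, rank and kernel vectors of matrices *)

Section LinearAlgebra.
Local Open Scope ring_scope.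

(** The lower left block of [M] is cleared in two ways. A column operation leaves the determinant
    [char_poly (C *m B)]; a row operation of determinant ['X^r] leaves
    ['X^n * char_poly (B *m C)]. *)
Lemma char_poly_mulC (R : comNzRingType) n r (C : 'M[R]_(n, r)) (B : 'M_(r, n)) :
  'X^r * char_poly (C *m B) = 'X^n * char_poly (B *m C).
Proof.
pose Cp := map_mx (@polyC R) C; pose Bp := map_mx (@polyC R) B.
pose M := block_mx ('X%:M : 'M[{poly R}]_n) Cp Bp (1%:M : 'M_r).
have detl : \det M = char_poly (C *m B).
  have := det_mulmx M (block_mx 1%:M 0 (- Bp) 1%:M).
  rewrite mulmx_block !mulmx0 !mulmx1 mul1mx mulmxN subrr !add0r.
  by rewrite det_ublock det_lblock !det1 !mulr1 -map_mxM.
have <- : \det (block_mx 1%:M 0 (- Bp) 'X%:M : 'M_(n + r)) = 'X^r.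
  by rewrite det_lblock det1 mul1r det_scalar.
rewrite -detl -det_mulmx mulmx_block !mul0mx !mul1mx !addr0 mulmx1 mulNmx.
rewrite -scalar_mxC addNr det_ublock det_scalar mulNmx addrC.
by rewrite /char_poly /char_poly_mx map_mxM.
Qed.

Lemma mulmx_tr_eq0 (F : realFieldType) m n (B : 'M[F]_(m, n)) : B *m B^T = 0 -> B = 0.
Proof.
move=> B0; apply/matrixP => i j; rewrite mxE.
have := congr1 (fun D : 'M_m => D i i) B0; rewrite /= !mxE => /eqP.
rewrite psumr_eq0 => [/allP /(_ j)|k _]; last by rewrite mxE -expr2 sqr_ge0.
by rewrite mem_index_enum mxE mulf_eq0 orbb => /(_ isT) /eqP.
Qed.

(* Writing [A = C *m B] with full rank factors, [B *m C] is invertible because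
   the kernel and the image of a symmetric matrix meet trivially. *)
Lemma mup0_char_poly_sym (F : realFieldType) n (A : 'M[F]_n) :
  A^T = A -> mup 0 (char_poly A) = (n - \rank A)%N.
Proof.
move=> Asym; pose C := col_base A; pose B := row_base A.
have BC : row_free (B *m C).
  rewrite -kermx_eq0; set K := kermx _.
  have KBA : K *m B *m A = 0.
    transitivity (K *m B *m (C *m B)); first by rewrite mulmx_base.
    by rewrite mulmxA -(mulmxA K) mulmx_ker mul0mx.
  have /submxP[D KB] : (K *m B <= A)%MS.
    by apply: submx_trans (submxMl _ _) _; rewrite eq_row_base.
  have KB0 : K *m B = 0.
    by apply: mulmx_tr_eq0; rewrite {2}KB trmx_mul Asym mulmxA KBA mul0mx.
  by apply/eqP; apply: (row_free_inj (row_base_free A)); rewrite KB0 mul0mx.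
have nr : ~~ root (char_poly (B *m C)) 0.
  rewrite rootE horner_coef0 char_poly_det mulf_eq0 negb_or signr_eq0.
  by rewrite -unitfE -unitmxE -row_free_unit.
have := congr1 (mup 0) (char_poly_mulC C B).
rewrite !mupM ?expf_neq0 ?polyX_eq0 ?monic_neq0 ?char_poly_monic // (mupNroot nr).
have mupX k : mup 0 ('X^k : {poly F}) = k.
  by have := mup_XsubCX k (0 : F) 0; rewrite subr0 eqxx.
rewrite !mupX mulmx_base addn0 => /(congr1 (subn^~ (\rank A))).
by rewrite /= addKn.
Qed.

Lemma rank_mxsub (F : fieldType) m n k l (A : 'M[F]_(m, n))
    (f : 'I_k -> 'I_m) (h : 'I_l -> 'I_n) :
  (\rank (mxsub f h A) <= \rank A)%N.
Proof.
have -> : mxsub f h A = rowsub f 1%:M *m A *m colsub h 1%:M.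
  by rewrite -rowsubE mulmx_colsub mulmx1; apply/matrixP => i j; rewrite !mxE.
exact: leq_trans (mxrankM_maxl _ _) (mxrankM_maxr _ _).
Qed.

Lemma rank_trig_mxsub (F : fieldType) m n k (A : 'M[F]_(m, n))
    (f : 'I_k -> 'I_m) (h : 'I_k -> 'I_n) :
  (forall i, A (f i) (h i) != 0) ->
  (forall i j : 'I_k, (i < j)%N -> A (f i) (h j) = 0) -> (k <= \rank A)%N.
Proof.
move=> diag trig; apply: leq_trans (rank_mxsub A f h).
suff : mxsub f h A \in unitmx by move/mxrank_unit->.
have /det_trig detE : is_trig_mx (mxsub f h A).
  by apply/is_trig_mxP => i j ij; rewrite mxE trig.
by rewrite unitmxE detE unitfE; apply/prodf_neq0 => i _; rewrite mxE.
Qed.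

(* Rows [a] and [b] span the row space. *)
Lemma sym_rank2_entry (F : fieldType) n (A : 'M[F]_n) (a b x y : 'I_n) :
  A^T = A -> A a a = 0 -> A b b = 0 -> A a b != 0 -> (\rank A <= 2)%N ->
  A x y * A a b = A x a * A b y + A x b * A a y.
Proof.
move=> Asym Aaa Abb Aab rkA.
have Aba : A b a = A a b by rewrite -{1}Asym mxE.
pose f (i : 'I_2) := if i == 0 then a else b.
have rkB : (2 <= \rank (rowsub f A))%N.
  apply: (@rank_trig_mxsub _ _ _ _ _ id (fun i : 'I_2 => if i == 0 then b else a)).
    by case=> [[|[|?]] //= ?]; rewrite mxE /f //= Aba.
  by case=> [[|[|?]] //= ?] [[|[|?]] //= ?] _; rewrite mxE /f.
have /submxP[D DE] : (row x A <= rowsub f A)%MS.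
  apply: submx_trans (row_sub x A) _.
  by rewrite -(mxrank_leqif_sup (rowsub_sub f A)) eqn_leq (rank_mxsub A f id) (leq_trans rkA).
have E z : A x z = D 0 0 * A a z + D 0 1 * A b z.
  have := congr1 (fun M : 'rV_n => M 0 z) DE.
  rewrite !mxE !big_ord_recl big_ord0 addr0 !mxE /= => ->.
  by congr (_ + D _ _ * _); apply: val_inj.
(* [E] at [b] and at [a] reads [A x b = D 0 0 * A a b] and [A x a = D 0 1 * A a b]. *)
rewrite !E Aaa Abb Aba !mulr0 add0r addr0 mulrDl.
by rewrite addrC mulrAC; congr (_ + _); rewrite mulrAC.
Qed.

Lemma rank_ker2 (F : fieldType) n (A : 'M[F]_n) (u v : 'rV_n) (i j : 'I_n) :
  u *m A = 0 -> v *m A = 0 -> u 0 i != 0 -> v 0 i = 0 -> v 0 j != 0 -> u 0 j = 0 ->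
  (\rank A <= n - 2)%N.
Proof.
move=> uA vA ui vi vj uj.
have : (\rank (col_mx u v) <= \rank (kermx A))%N.
  by apply: mxrankS; apply/sub_kermxP; rewrite mul_col_mx uA vA col_mx0.
rewrite mxrank_ker => le1; have := rank_leq_row A.
suff : (2 <= \rank (col_mx u v))%N by lia.
apply: (@rank_trig_mxsub _ _ _ _ _ id (fun k : 'I_2 => if (k : nat) == 0%N then i else j)).
  by move=> k; rewrite mxE; case: splitP => k'; rewrite ord1 /= => ->.
move=> k l kl; have /eqP k0 : k == 0%N :> nat by have := ltn_ord l; lia.
by rewrite mxE; case: splitP => k'; rewrite ord1 k0 // => _; rewrite eqn0Ngt (leq_trans _ kl).
Qed.

(** Appending the unit column [delta_mx i 0] raises the rank by at most one and adds the condition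
    [u 0 i = 0] to the kernel. *)
Lemma ker_vanishing_at (F : fieldType) n (A : 'M[F]_n) (i : 'I_n) :
  (\rank A < n.-1)%N -> exists u : 'rV_n, [/\ u != 0, u *m A = 0 & u 0 i = 0].
Proof.
move=> rkA; pose M := row_mx A (delta_mx i 0 : 'cV_n).
have : kermx M != 0.
  rewrite kermx_eq0 /row_free -mxrank_tr tr_row_mx -addsmxE.
  have le := leq_of_leqif (mxrank_adds_leqif A^T ((delta_mx i 0 : 'cV[F]_n)^T)).
  move: le; rewrite !mxrank_tr mxrank_delta; lia.
case/rowV0Pn=> u /sub_kermxP; rewrite mul_mx_row -[0 in RHS]row_mx0 => /eq_row_mx[uA ui] u0.
exists u; split=> //; have := congr1 (fun M : 'M_1 => M 0 0) ui.
by rewrite -colE !mxE.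
Qed.

End LinearAlgebra.

(** * Rank of the adjacency matrix in terms of vertices *)

Section AdjacencyRank.
Variables (T : finType) (e : rel T) (s : T -> T -> bool).
Hypotheses (e_sym : symmetric e) (e_irr : irreflexive e).
Hypothesis s_sym : forall u v, s u v = s v u.
Local Open Scope ring_scope.

Definition adj (u v : T) : rat := if e u v then (-1) ^+ s u v else 0.
Definition rk : nat := \rank (sadj e s).

Lemma sadjE i j : sadj e s i j = adj (enum_val i) (enum_val j).
Proof. by rewrite mxE /adj /sgn_entry; case: (e _ _) => //; case: (s _ _). Qed.

Lemma sadj_rank u v : sadj e s (enum_rank u) (enum_rank v) = adj u v.
Proof. by rewrite sadjE !enum_rankK. Qed.

Lemma adj_neq0 u v : (adj u v != 0) = e u v.
Proof. by rewrite /adj; case: (e _ _); rewrite ?eqxx ?signr_eq0. Qed.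

Lemma adj_sym u v : adj u v = adj v u.
Proof. by rewrite /adj e_sym s_sym. Qed.

Lemma sadj_sym : (sadj e s)^T = sadj e s.
Proof. by apply/matrixP => i j; rewrite mxE !sadjE adj_sym. Qed.

Lemma nullityE : nullity e s = (#|T| - rk)%N.
Proof. exact: mup0_char_poly_sym sadj_sym. Qed.

Lemma rk_triangular k (x y : nat -> T) :
  (forall i, i < k -> e (x i) (y i))%N ->
  (forall i j, i < j < k -> ~~ e (x i) (y j))%N -> (k <= rk)%N.
Proof.
move=> diag trig.
apply: (@rank_trig_mxsub _ _ _ _ _
  (fun i : 'I_k => enum_rank (x i)) (fun i => enum_rank (y i))).
  by move=> i; rewrite sadj_rank adj_neq0 diag.
by move=> i j ij; apply/eqP; rewrite sadj_rank -[_ == 0]negbK adj_neq0 trig // ij /=.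
Qed.

Lemma rk_edge a b : e a b -> (2 <= rk)%N.
Proof.
move=> eab; apply: (@rk_triangular 2 (fun i => if i is 0%N then a else b)
                                     (fun i => if i is 0%N then b else a)).
  by case=> [|i] //= _; rewrite e_sym.
by move=> i j ijk; have [-> ->] : i = 0%N /\ j = 1%N; [lia | rewrite /= e_irr].
Qed.

Lemma mul_row_sadj (f : T -> rat) j :
  ((\row_i f (enum_val i)) *m sadj e s) 0 j = \sum_u f u * adj u (enum_val j).
Proof.
rewrite mxE [RHS](reindex (@enum_val T predT)); last first.
  exact: onW_bij (@enum_val_bij T).
by apply: eq_bigr => i _; rewrite sadjE mxE.
Qed.

Lemma rk_ker2 (f h : T -> rat) a b :
  (forall v, \sum_u f u * adj u v = 0) -> (forall v, \sum_u h u * adj u v = 0) ->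
  f a != 0 -> h a = 0 -> h b != 0 -> f b = 0 -> (rk <= #|T| - 2)%N.
Proof.
move=> kf kh fa ha hb fb.
apply: (@rank_ker2 _ _ _ (\row_i f (enum_val i)) (\row_i h (enum_val i))
          (enum_rank a) (enum_rank b)); rewrite ?mxE ?enum_rankK //;
  by apply/rowP => j; rewrite mul_row_sadj mxE.
Qed.

Lemma ker_fun_vanishing_at a : (rk < #|T|.-1)%N -> exists f : T -> rat,
  [/\ exists v, f v != 0, forall v, \sum_u f u * adj u v = 0 & f a = 0].
Proof.
case/(ker_vanishing_at (enum_rank a))=> w [w0 wA wa].
exists (fun v => w 0 (enum_rank v)); split=> //.
  by case/rV0Pn: w0 => j wj; exists (enum_val j); rewrite enum_valK.
move=> v; have := mul_row_sadj (fun v => w 0 (enum_rank v)) (enum_rank v).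
rewrite enum_rankK => <-; rewrite (_ : \row__ _ = w) ?wA ?mxE //.
by apply/rowP => i; rewrite mxE enum_valK.
Qed.

(** * Rank two and complete bipartite graphs *)

Section RankTwo.
Hypothesis rk2 : (rk <= 2)%N.

Lemma adj_rk2 a b x y :
  e a b -> adj x y * adj a b = adj x a * adj b y + adj x b * adj a y.
Proof.
move=> eab; have adj0 u : adj u u = 0 by rewrite /adj e_irr.
have := @sym_rank2_entry _ _ _ (enum_rank a) (enum_rank b) (enum_rank x) (enum_rank y) sadj_sym.
by rewrite !sadj_rank !adj0 adj_neq0; apply.
Qed.

(** The parts are the neighbourhoods of [a] and [b]. A vertex adjacent to neither would have a zero
    row by [adj_rk2], against connectedness; one adjacent to both would close a triangle. *)
Lemma rk2_Kpos a b : e a b -> connected e ->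
  (forall u v w, e u v -> e v w -> ~~ e w u) -> switching_equiv_Kpos e s.
Proof.
move=> eab conn notri.
have nbr x : exists y, e x y.
  have [z xz] : exists z, x != z.
    have [xa|] := eqVneq x a; last by exists a.
    by exists b; apply: contraTneq eab => <-; rewrite xa e_irr.
  case/connectP: (conn x z) => -[|y p] /=; first by move=> _ /esym /eqP; rewrite (negPf xz).
  by case/andP=> xy _ _; exists y.
have nbr_ab x : e x a || e x b.
  case: (nbr x) => y; rewrite -adj_neq0; apply: contraTT.
  rewrite negb_or -!adj_neq0 !negbK => /andP[/eqP xa /eqP xb].
  have := adj_rk2 x y eab; rewrite xa xb !mul0r addr0 => /eqP.
  by rewrite mulf_eq0 -[adj a b == 0]negbK adj_neq0 eab orbF.
have nxb x : e x a -> e x b = false.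
  by move=> xa; apply/negbTE; rewrite e_sym; apply: notri xa eab.
have same x y c : e x c -> e y c -> e x y = false.
  by move=> xc yc; apply/negbTE/(@notri y c); rewrite // e_sym.
have sAB x y : e x a -> e y b -> adj x y * adj a b = adj x a * adj y b.
  move=> xa yb; rewrite (adj_rk2 _ _ eab) (adj_sym b); have := nxb _ xa.
  by rewrite -(adj_neq0 x b) => /negbFE/eqP->; rewrite mul0r addr0.
have eAB x y : e x a -> e y b -> e x y.
  move=> xa yb; rewrite -adj_neq0; have := sAB _ _ xa yb.
  apply: contra_eqN => /eqP->; rewrite mul0r eq_sym mulf_eq0 negb_or !adj_neq0.
  by rewrite xa yb.
have eE x y : e x y = (e x a != e y a).
  have [xa|xa] := boolP (e x a); have [ya|ya] := boolP (e y a) => /=.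
  - exact: same xa ya.
  - by apply: eAB => //; have := nbr_ab y; rewrite (negPf ya).
  - by rewrite e_sym; apply: eAB => //; have := nbr_ab x; rewrite (negPf xa).
  - by apply: (@same _ _ b); [have := nbr_ab x | have := nbr_ab y]; rewrite ?(negPf xa) ?(negPf ya).
split.
  exists [set x | e x a]; split.
  - by apply/set0Pn; exists b; rewrite inE e_sym.
  - by apply/set0Pn; exists a; rewrite !inE e_irr.
  - by move=> x y; rewrite !inE.
(* Chosen so that [theta x (+) theta y = s x y] across the parts, by the sign identity [signAB]. *)
pose theta x := if e x a then s a b (+) s x a else s x b.
have signAB x y : e x a -> e y b -> s x y (+) s a b = s x a (+) s y b.
  move=> xa yb; have := sAB _ _ xa yb; rewrite /adj eab xa yb eAB //.
  by case: (s x y); case: (s a b); case: (s x a); case: (s y b).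
have switchAB x y : e x a -> e y b -> e y a = false -> switch theta s x y = false.
  move=> xa yb ya; have := signAB _ _ xa yb; rewrite /switch /theta xa ya.
  by case: (s x y); case: (s a b); case: (s x a); case: (s y b).
exists theta => x y; rewrite eE.
have [xa|xa] := boolP (e x a); have [ya|ya] := boolP (e y a) => //= _.
  by apply: switchAB => //; [have := nbr_ab y|]; rewrite (negPf ya).
rewrite (_ : switch _ _ _ _ = switch theta s y x).
  by apply: switchAB => //; [have := nbr_ab x|]; rewrite (negPf xa).
by rewrite /switch (s_sym x); case: (theta x); case: (theta y); case: (s y x).
Qed.

End RankTwo.

(** With [u b] the switching signs restricted to one part, the matrix is a sum of two outer
    products. *)
Lemma Kpos_rk : switching_equiv_Kpos e s -> (rk <= 2)%N.
Proof.
case=> -[A [_ _ eE]] [theta sE].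
pose f (b : bool) x : rat := if (x \in A) == b then (-1) ^+ theta x else 0.
pose u b : 'rV[rat]_#|T| := \row_i f b (enum_val i).
have -> : rk = \rank ((u true)^T *m u false + (u false)^T *m u true)%R.
  congr (\rank _); apply/matrixP => i j; rewrite sadjE !mxE !big_ord1 !mxE /adj /f.
  set x := enum_val i; set y := enum_val j; have := sE x y; rewrite eE /switch.
  case: (x \in A); case: (y \in A) => /=; rewrite ?mul0r ?mulr0 ?addr0 ?add0r // => /(_ isT);
  by case: (theta x); case: (theta y); case: (s x y).
apply: leq_trans (mxrank_add _ _) _.
by apply: (@leq_add _ _ 1 1); apply: mulmx_max_rank.
Qed.

Lemma Kpos_no_triangle u v w : complete_bipartite e -> e u v -> e v w -> ~~ e w u.
Proof.
by case=> A [_ _ eE]; rewrite !eE; case: (u \in A); case: (v \in A); case: (w \in A).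
Qed.

End AdjacencyRank.

(** * Shortest cycles: chords and outside neighbours *)

Section ShortestCycle.
Variables (T : finType) (e : rel T) (s : T -> T -> bool) (c : seq T) (x0 : T).
Hypotheses (e_sym : symmetric e) (e_irr : irreflexive e).
Hypothesis s_sym : forall u v, s u v = s v u.
Hypothesis cycc : is_cycle e c.
Hypothesis minc : forall c', is_cycle e c' -> size c <= size c'.

Local Notation g := (size c).

(** Indices are taken modulo [g], so that arcs may wrap around the list. *)
Definition vtx i := nth x0 c (i %% g).

Lemma cyc_ge3 : 3 <= g. Proof. by case/and3P: cycc. Qed.

Lemma cyc_uniq : uniq c. Proof. by case/and3P: cycc. Qed.

Let g_gt0 : 0 < g. Proof. exact: leq_trans cyc_ge3. Qed.

Lemma vtx_in i : vtx i \in c. Proof. by rewrite mem_nth ?ltn_pmod. Qed.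

Lemma index_vtx i : index (vtx i) c = i %% g.
Proof. by rewrite index_uniq ?ltn_pmod ?cyc_uniq. Qed.

Lemma vtx_index v : v \in c -> vtx (index v c) = v.
Proof. by move=> vc; rewrite /vtx modn_small ?index_mem // nth_index. Qed.

Lemma vtxD i : vtx (i + g) = vtx i.
Proof. by rewrite /vtx modnDr. Qed.

(** Shifting the window by one drops only the index [m], and [m + g] names the same vertex. *)
Lemma vtx_window m v : v \in c -> exists2 k, m <= k < m + g & vtx k = v.
Proof.
move=> vc; elim: m => [|m [k mk kv]].
  by exists (index v c); rewrite ?vtx_index // index_mem.
have [km|km] := eqVneq k m; last by exists k => //; lia.
by exists (k + g); rewrite ?vtxD // km; have := g_gt0; lia.
Qed.

Lemma vtx_neq i j : i < j < i + g -> vtx i != vtx j.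
Proof.
move=> /andP[ij jig]; rewrite nth_uniq ?ltn_pmod ?cyc_uniq // eq_sym eqn_mod_dvd 1?ltnW //.
by apply: contraL jig => /dvdn_leq; rewrite subn_gt0 ij => /(_ isT); lia.
Qed.

Lemma vtxS i : vtx i.+1 = nth x0 (rot 1 c) (i %% g).
Proof.
rewrite /vtx -addn1 -modnDml addn1; have := ltn_pmod i g_gt0.
case: (c) => //= y c' r_lt; rewrite rot1_cons nth_rcons.
have [r_lt'|] := ltnP (i %% (size c').+1) (size c'); first by rewrite modn_small.
move=> le; have -> : i %% (size c').+1 = size c' by apply/eqP; rewrite eqn_leq le andbT.
by rewrite modnn eqxx.
Qed.

Lemma next_vtx i : next c (vtx i) = vtx i.+1.
Proof.
rewrite next_nth vtx_in index_vtx vtxS; have := ltn_pmod i g_gt0.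
case: (c) => //= y c' r_lt; rewrite rot1_cons nth_rcons.
case: ltngtP => [lt|lt|->]; first exact: set_nth_default.
  by move: r_lt; rewrite ltnS leqNgt lt.
by rewrite nth_default.
Qed.

Lemma vtx_edge i : e (vtx i) (vtx i.+1).
Proof. by rewrite -next_vtx; apply: next_cycle (vtx_in i); case/and3P: cycc. Qed.

Definition arc i m := [seq vtx j | j <- iota i m].

Lemma arc_uniq i m : m <= g -> uniq (arc i m).
Proof.
move=> mg; rewrite map_inj_in_uniq ?iota_uniq // => j k; rewrite !mem_iota => jm km vjk.
have [jk|kj|//] := ltngtP j k; exfalso.
  by have /eqP[] : vtx j != vtx k by apply: vtx_neq; lia.
by have /eqP[] : vtx k != vtx j by apply: vtx_neq; lia.
Qed.

Lemma arc_path i m : path e (vtx i) (arc i.+1 m).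
Proof. by elim: m i => //= m IH i; rewrite vtx_edge /=; apply: IH. Qed.

Lemma last_arc i m : last (vtx i) (arc i.+1 m) = vtx (i + m).
Proof. by elim: m i => [|m IH] i /=; rewrite ?addn0 // IH addSnnS. Qed.

(** The edge closes the arc from [i] to [j] into a cycle of [j - i + 1] vertices, which minimality
    excludes unless this number is 2 or at least [g]. *)
Lemma chordless i j : i < j < i + g -> e (vtx i) (vtx j) -> j = i.+1 \/ j = (i + g).-1.
Proof.
move=> ijg eij; have [|ij1] := eqVneq j i.+1; first by left.
right; have : is_cycle e (arc i (j - i).+1).
  rewrite /is_cycle size_map size_iota arc_uniq; last by lia.
  rewrite /= rcons_path arc_path last_arc (_ : i + (j - i) = j) 1?e_sym ?eij; lia.
by move/minc; rewrite size_map size_iota; lia.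
Qed.

Lemma outside_arc u i j : u \notin c -> i < j < i + g ->
  e u (vtx i) -> e u (vtx j) -> g <= (j - i).+2.
Proof.
move=> uc ijg ui uj; have : is_cycle e (u :: arc i (j - i).+1).
  rewrite /is_cycle cons_uniq arc_uniq; last by lia.
  rewrite /= size_map size_iota rcons_path arc_path last_arc (_ : i + (j - i) = j) 1?(e_sym _ u) ?ui ?uj; last by lia.
  rewrite !andbT; apply/andP; split; first by lia.
  by apply: contra uc => /mapP[k _ ->]; apply: vtx_in.
by move/minc; rewrite /= size_map size_iota.
Qed.

(** Both arcs between the two neighbours close up through [u]. Their lengths add up to [g], so
    [2 * g <= g + 4]. *)
Lemma outside_two u i j : u \notin c -> i < j < i + g ->
  e u (vtx i) -> e u (vtx j) -> g <= 4.
Proof.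
move=> uc ijg ui uj; have := outside_arc uc ijg ui uj.
have := @outside_arc u j (i + g) uc; rewrite vtxD => /(_ _ uj ui); lia.
Qed.

(** The index gap [t - i + 1] lies between 2 and [g - 2], while edges have gap 1 or [g - 1]. *)
Lemma chordless_triangular i t : i < t < g - 2 -> forall m, ~~ e (vtx (m + i).+1) (vtx (m + t).+2).
Proof.
move=> itg m; apply/negP => /chordless; lia.
Qed.

Lemma rk_shortest_cycle : g - 2 <= rk e s.
Proof.
apply: (@rk_triangular _ _ _ _ (fun i => vtx i.+1) (fun i => vtx i.+2)) => [i _|i j ij].
  exact: vtx_edge.
by apply: (@chordless_triangular i j _ 0); lia.
Qed.

(** The row [u] and the column [vtx a] go in front of the triangle of size [g - 2] that starts at
    [a]; a further nonzero entry in row [u] would be a second neighbour on the cycle. *)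
Lemma rk_outside_neighbour u v : 4 < g -> u \notin c -> v \in c -> e u v -> g.-1 <= rk e s.
Proof.
move=> g4 uc vc uv; have av := vtx_index vc; set a := index v c in av.
apply: (@rk_triangular _ _ _ _
  (fun i => if i is k.+1 then vtx (a + k).+1 else u)
  (fun i => if i is k.+1 then vtx (a + k).+2 else vtx a)).
  by case=> [|k] _; rewrite ?av // vtx_edge.
case=> [|i] [|j] // ijg; last by apply: chordless_triangular; lia.
by apply/negP => uj; have := @outside_two u a (a + j).+2 uc; rewrite av; lia.
Qed.

(** * Signs along the cycle and the closing condition *)

Definition negs i := \sum_(j < i) s (vtx j) (vtx j.+1).

Lemma negsS i : negs i.+1 = negs i + s (vtx i) (vtx i.+1).
Proof. exact: big_ord_recr. Qed.

Lemma negsD i : negs (g + i) = negs g + negs i.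
Proof.
rewrite /negs big_split_ord; congr (_ + _); apply: eq_bigr => j _ /=.
by rewrite -addnS !(addnC g) !vtxD.
Qed.

Lemma balancedE : balanced_cycle s c = ~~ odd (negs g).
Proof.
congr (~~ odd _); have -> : cycle_edges c = [seq (vtx i, vtx i.+1) | i <- iota 0 g].
  apply: (@eq_from_nth _ (x0, x0)) => [|i];
    rewrite size_zip size_rot minnn ?size_map ?size_iota // => ig.
  rewrite nth_zip ?size_rot // (nth_map 0) ?size_iota // nth_iota //= add0n; congr (_, _).
    by rewrite /vtx modn_small.
  by rewrite vtxS modn_small.
rewrite count_map -sum1_count big_mkcond /= -{1}(subn0 g) -/(index_iota 0 g) big_mkord.
by apply: eq_bigr => i _; case: s.
Qed.

(** For even [g] the second factor says that (-1)^(g/2) times the product of the edge signs is 1. *)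
Definition nullity_cond := ~~ odd g && ~~ odd (g./2 + negs g).

Lemma nullity_condE :
  nullity_cond = (balanced_cycle s c && (g %% 4 == 0)) || (~~ balanced_cycle s c && (g %% 4 == 2)).
Proof.
rewrite balancedE negbK /nullity_cond oddD.
have -> : odd g = odd (g %% 4) by lia.
have -> : odd g./2 = odd (g %% 4)./2 by lia.
have : g %% 4 < 4 by rewrite ltn_mod.
by case: (g %% 4) => [|[|[|[|?]]]] //= _; case: (odd (negs g)).
Qed.

(** * Kernel vectors when the cycle spans the graph *)

Section Spanning.
Hypothesis span : forall v, v \in c.
Local Open Scope ring_scope.
Local Notation adj := (adj e s).

Lemma span_graph_is_cycle : graph_is_cycle e c.
Proof.
split=> //; split.
  have /card_uniqP <- := cyc_uniq.
  by apply: eq_card => v; rewrite span.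
move=> u v uv; have [k _ kv] := vtx_window 0 (span u); have [l kl lv] := vtx_window k (span v).
move: uv; rewrite -kv -lv => uv; rewrite !next_vtx.
have kl' : (k < l < k + g)%N.
  by have [E|] := eqVneq l k; [move: uv; rewrite E e_irr | lia].
case: (chordless kl' uv) => ->; rewrite ?eqxx // (_ : (k + g).-1.+1 = k + g)%N ?vtxD ?eqxx ?orbT //.
lia.
Qed.

Lemma vtx_neighbour v i : e v (vtx i.+1) -> v = vtx i \/ v = vtx i.+2.
Proof.
have [k ik <-] := vtx_window i.+1 (span v); rewrite e_sym.
have [->|ki] := eqVneq k i.+1; first by rewrite e_irr.
move/chordless => []; [lia|move->; by right|].
by rewrite addSn /= => ->; left; rewrite vtxD.
Qed.

Lemma sum_adj_vtx (f : T -> rat) i : \sum_u f u * adj u (vtx i.+1) =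
  f (vtx i) * (-1) ^+ s (vtx i) (vtx i.+1) + f (vtx i.+2) * (-1) ^+ s (vtx i.+1) (vtx i.+2).
Proof.
have ne : vtx i.+2 != vtx i by rewrite eq_sym vtx_neq //; have := cyc_ge3; lia.
rewrite (bigD1 (vtx i)) // (bigD1 (vtx i.+2)) //= big1 => [|u /andP[u1 u2]]; last first.
  apply/eqP; rewrite mulf_eq0 -[adj _ _ == 0]negbK adj_neq0.
  apply/orP; right; apply/negP => /vtx_neighbour[] /eqP; by rewrite ?(negPf u1) ?(negPf u2).
by rewrite addr0 (adj_sym e_sym s_sym (vtx i.+2)) /adj !vtx_edge.
Qed.

(* The solution of [a_i x_i + a_(i+1) x_(i+2) = 0] along one parity class. *)
Definition walk_weight i : rat := (-1) ^+ (i./2 + negs i).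

Lemma walk_weightSS i : walk_weight i.+2 =
  - (walk_weight i * (-1) ^+ s (vtx i) (vtx i.+1) * (-1) ^+ s (vtx i.+1) (vtx i.+2)).
Proof.
rewrite /walk_weight !negsS /= -!exprD -[RHS]mulN1r -exprS; congr (_ ^+ _); lia.
Qed.

Lemma walk_weight_neq0 i : walk_weight i != 0.
Proof. by rewrite signr_eq0. Qed.

Lemma nullity_cond_weight : ~~ odd g -> nullity_cond = (walk_weight g == 1).
Proof.
by rewrite /nullity_cond /walk_weight -signr_odd => ->; case: odd.
Qed.

(** A kernel vector vanishing at [vtx 1] is 0 at all odd indices, and the recursion makes the even
    terms multiples of [f (vtx 0)]. Comparing indices 0 and [g], which name one vertex, yields the
    condition. *)
Lemma rk_small_nullity_cond : (rk e s < g.-1)%N -> nullity_cond.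
Proof.
have cardT : #|T| = g by case: span_graph_is_cycle => _ [].
rewrite -{1}cardT => /(@ker_fun_vanishing_at _ e s (vtx 1))[f [[v fv] kf f1]].
have fE i : f (vtx i) = if odd i then 0 else walk_weight i * f (vtx 0).
  (* Consecutive indices are proved together because the recursion has step two. *)
  have [] // : f (vtx i) = (if odd i then 0 else walk_weight i * f (vtx 0)) /\
     f (vtx i.+1) = (if odd i.+1 then 0 else walk_weight i.+1 * f (vtx 0)).
  elim: i => [|i [IH1 IH2]]; first by rewrite /walk_weight /negs big_ord0 expr0 mul1r.
  split=> //; have := kf (vtx i.+1); rewrite sum_adj_vtx IH1 /= negbK walk_weightSS.
  case: odd; [move=> /eqP; rewrite mul0r add0r mulf_eq0 signr_eq0 orbF => /eqP // |].
  set a := (_ ^+ s (vtx i) _); set b := (_ ^+ s _ _); set w := walk_weight i.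
  have bb : b * b = 1 by rewrite -expr2 sqrr_sign.
  rewrite addrC => /eqP; rewrite addr_eq0 => /eqP yb.
  have -> : f (vtx i.+2) = f (vtx i.+2) * b * b by rewrite -mulrA bb mulr1.
  rewrite yb.
  by ring.
have f0 : f (vtx 0) != 0.
  apply: contraNneq fv => f0; have [k _ <-] := vtx_window 0 (span v).
  by rewrite fE f0 mulr0 if_same.
have := fE g; rewrite -{1}[g]add0n vtxD.
(* For odd [g] the value at [vtx g] would be 0, yet it equals [f (vtx 0)]. *)
case: (boolP (odd g)) => [og /eqP|og]; first by rewrite (negPf f0).
by rewrite nullity_cond_weight // -{1}[f _]mul1r => /(mulIf f0) ->.
Qed.

(** Two candidates, supported on the even and on the odd indices; the value is read at the index
    below [g]. *)
Definition cyclic_ker (b : bool) v : rat :=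
  let i := index v c in if odd i == b then walk_weight i else 0.

Lemma nullity_cond_rk : nullity_cond -> (rk e s <= g - 2)%N.
Proof.
move=> nc; have og : ~~ odd g by case/andP: nc.
have w1 : walk_weight g = 1 by apply/eqP; rewrite -nullity_cond_weight.
(* The condition makes the weight [g]-periodic, so the formula holds at every index of a vertex,
   also across the closing edge. *)
have wD i : walk_weight (i + g) = walk_weight i.
  rewrite -[RHS]mul1r -w1 /walk_weight (addnC i) negsD halfD (negPf og) /= add0n -exprD.
  by congr (_ ^+ _); lia.
have kE b i : cyclic_ker b (vtx i) = if odd i == b then walk_weight i else 0.
  rewrite /cyclic_ker index_vtx [i in RHS](divn_eq i g); elim: (i %/ g)%N => [|m ->] /=.
    by rewrite mul0n add0n.
  by rewrite mulSn -addnA (addnC g) [in RHS]oddD (negPf og) addbF wD.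
have ker b v : \sum_u cyclic_ker b u * adj u v = 0.
  (* A window starting at 1 writes every vertex as [vtx k.+1], the form in [sum_adj_vtx]. *)
  have [[|k] // _ <-] := vtx_window 1 (span v).
  rewrite sum_adj_vtx !kE /= negbK; case: (odd k == b); rewrite ?mul0r ?addr0 // walk_weightSS.
  by rewrite mulNr -[X in _ - X]mulrA -expr2 sqrr_sign mulr1 subrr.
have cardT : #|T| = g by case: span_graph_is_cycle => _ [].
rewrite -{1}cardT; apply: (@rk_ker2 _ _ _ (cyclic_ker false) (cyclic_ker true) (vtx 0) (vtx 1));
  by rewrite ?kE // walk_weight_neq0.
Qed.

End Spanning.
End ShortestCycle.

(** * The bound and the equality cases *)

Theorem theorem5p1 (T : finType) (e : rel T) (s : T -> T -> bool) (g : nat)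
  (e_sym : symmetric e) (e_irr : irreflexive e)
  (s_sym : forall u v, s u v = s v u)
  (e_conn : connected e)
  (e_cyc : exists c, is_cycle e c)
  (e_girth : girth e g) :
  (nullity e s <= #|T| - g + 2)%N /\
  ((nullity e s = #|T| - g + 2)%N <->
     ((exists c, graph_is_cycle e c /\ size c = g /\
         balanced_cycle s c /\ g %% 4 = 0)%N \/
      (exists c, graph_is_cycle e c /\ size c = g /\
         ~~ balanced_cycle s c /\ g %% 4 = 2)%N \/
      switching_equiv_Kpos e s)).
Proof.
case: e_girth => -[c [cycc cg]] ming.
have minc c' : is_cycle e c' -> size c <= size c' by rewrite cg; apply: ming.
have [x0 x0c] : exists x, x \in c.
  by case: (c) cycc => [|x c'] //; exists x; rewrite mem_head.
have g3 : 3 <= g by rewrite -cg; apply: cyc_ge3 cycc.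
have gT : g <= #|T|.
  by rewrite -cg -(card_uniqP (cyc_uniq cycc)) max_card.
have rkT : rk e s <= #|T| by apply: rank_leq_row.
have rkg : g - 2 <= rk e s by rewrite -cg; apply: (rk_shortest_cycle s x0 e_sym cycc minc).
have e01 : e (vtx c x0 0) (vtx c x0 1) by apply: vtx_edge.
rewrite (nullityE e_sym s_sym); split; first by lia.
(* The truncated subtractions are exact: [3 <= g <= #|T|] and [rk e s <= #|T|]. *)
have -> : (#|T| - rk e s = #|T| - g + 2)%N <-> (rk e s = g - 2)%N by lia.
have spanning_rk c' : graph_is_cycle e c' -> size c' = g ->
    nullity_cond s c' x0 -> (rk e s = g - 2)%N.
  case=> cyc' [sizeT _] sg nc; have min' c2 : is_cycle e c2 -> size c' <= size c2.
    by rewrite sg; apply: ming.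
  have span' v : v \in c'.
    have cardE : #|c'| = #|T| by rewrite (card_uniqP (cyc_uniq cyc')).
    by rewrite (subset_cardP cardE (subset_predT _)).
  have := nullity_cond_rk e_sym e_irr s_sym cyc' min' span' nc; rewrite sg; lia.
split=> [rkE | [|[]]].
- have rk2 := rk_edge s e_sym e_irr e01.
  (* Since the rank [g - 2] is at least 2, [g <= 4] means [g = 4] and rank 2. *)
  have [g4|g4] := leqP g 4.
    right; right; apply: (rk2_Kpos e_sym e_irr s_sym _ e01) => //; first by lia.
    move=> u v w uv vw; apply/negP => wu.
    have : is_cycle e [:: u; v; w].
      rewrite /is_cycle /= uv vw wu !inE !andbT negb_or.
      have ne a b : e a b -> a != b by apply: contraTneq => ->; rewrite e_irr.
      by rewrite (ne _ _ uv) (ne _ _ vw) eq_sym (ne _ _ wu).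
    by move/ming => /=; lia.
  have span v : v \in c.
    apply/negPn/negP => vc.
    (* By connectedness an edge leaves the cycle, which forces rank at least [g - 1]. *)
    have /existsP[x /existsP[y /and3P[xy xc yc]]] :
        [exists x, exists y, [&& e x y, x \notin c & y \in c]].
      apply: contraNT vc => /existsPn noxy.
      suff clo : closed e (mem c) by rewrite -(closed_connect clo (e_conn x0 v)).
      apply: intro_closed; first exact: sym_connect_sym.
      move=> x y xy xc; apply: contraNT (noxy y) => yc.
      by apply/existsP; exists x; rewrite e_sym xy yc.
    have := rk_outside_neighbour s x0 e_sym cycc minc _ xc yc xy.
    by rewrite cg => /(_ g4); lia.
  have rk_lt : rk e s < (size c).-1 by lia.
  have := rk_small_nullity_cond x0 e_sym e_irr s_sym cycc minc span rk_lt.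
  have gic := span_graph_is_cycle x0 e_sym e_irr cycc minc span.
  rewrite (nullity_condE s x0 cycc) cg => /orP[] /andP[bal /eqP gmod];
    by [left; exists c | right; left; exists c].
- case=> c' [gic [sg [bal gmod]]]; apply: (spanning_rk c') => //.
  by rewrite (nullity_condE s x0 gic.1) ?sg ?bal ?gmod.
- case=> c' [gic [sg [bal gmod]]]; apply: (spanning_rk c') => //.
  by rewrite (nullity_condE s x0 gic.1) ?sg ?bal ?gmod ?orbT.
move=> K; have K2 := Kpos_rk K.
(* From [g - 2 <= rk e s <= 2] only [g = 3] and [g = 4] remain; the latter gives rank 2, and a
   bipartite graph has no triangle. *)
suff : g <> 3 by lia.
move=> gE; have : size c = 3 by lia.
case: (c) cycc => [|x [|y [|z []]]] //= /and3P[_ _ /= /and4P[xy yz zx _]] _.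
by have := Kpos_no_triangle K.1 xy yz; rewrite zx.
Qed.
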